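(* Let $\mathcal K$ be a Fraïssé class of quivers which is additionally closed under mutation, and let $Q_{\mathcal K}$ be its Fraïssé limit. Then every quiver obtained from $Q_{\mathcal K}$ by a finite sequence of mutations is isomorphic to $Q_{\mathcal K}$; that is, up to identifying isomorphic quivers, the finite-mutation-equivalence class of $Q_{\mathcal K}$ is a singleton.
   Context: A quiver on a set $X$ is a function $Q:X\times X\to\mathbb{Z}$ with $Q(x,y)=-Q(y,x)$. Mutation at $x\in X$: $\mu_x(Q)(v,w)=-Q(v,w)$ if $x\in\{v,w\}$, otherwise $Q(v,w)+Q(v,x)[Q(x,w)]_++[-Q(v,x)]_+Q(x,w)$, $[a]_+=\max(a,0)$. An isomorphism of quivers $A\to B$ is a bijection $f$ of vertex sets with $B(f(a),f(a'))=A(a,a')$; an embedding $A\hookrightarrow B$ is an injection with this property (i.e. an isomorphism onto a full subquiver, the restriction of $B$ to a vertex subset). A quiver $Q$ is homogeneous if every isomorphism between full subquivers of $Q$ on finite vertex sets extends to an automorphism of $Q$. A class $\mathcal K$ of quivers on finite vertex sets is a Fraïssé class if it is closed under isomorphism, hereditary (full subquivers of members are members), has the joint embedding property (any $A,B\in\mathcal K$ embed in a common $C\in\mathcal K$) and the amalgamation property (for embeddings $f:A\hookrightarrow B$, $g:A\hookrightarrow C$ in $\mathcal K$ there are $D\in\mathcal K$ and embeddings $f':B\hookrightarrow D$, $g':C\hookrightarrow D$ with $f'\circ f=g'\circ g$). The age of $Q$ is the class of finite quivers embedding into $Q$. By Fraïssé's theorem a Fraïssé class $\mathcal K$ has a unique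 up to isomorphism countable homogeneous quiver $Q_{\mathcal K}$ with age $\mathcal K$, its Fraïssé limit. $\mathcal K$ is closed under mutation if $\mu_x(A)\in\mathcal K$ for all $A\in\mathcal K$ and all vertices $x$ of $A$. *)

(* Defs.v *)
From HB Require Import structures.
From mathcomp Require Import all_boot all_order all_algebra.
From mathcomp Require Import finmap.
From mathcomp Require Import ring.
Set Implicit Arguments.
Unset Strict Implicit.
Unset Printing Implicit Defensive.
Import Order.TTheory GRing.Theory Num.Theory.
Local Open Scope ring_scope.

Record quiver (X : Type) := Quiver {
  arrows :> X -> X -> int;
  arrows_skew : forall x y, arrows x y = - arrows y x }.

Definition pos_part (a : int) : int := Num.max a 0.

Definition mutation_fun (X : eqType) (x : X) (Q : quiver X) (v w : X) : int :=
  if (x == v) || (x == w) then - Q v w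
  else Q v w + Q v x * pos_part (Q x w) + pos_part (- Q v x) * Q x w.

Lemma mutation_skew (X : eqType) (x : X) (Q : quiver X) (v w : X) :
  mutation_fun x Q v w = - mutation_fun x Q w v.
Proof.
rewrite /mutation_fun orbC (arrows_skew Q w v).
case: ifP => _; first by rewrite opprK.
rewrite (arrows_skew Q w x) (arrows_skew Q x v) opprK; ring.
Qed.

Definition mutation (X : eqType) (x : X) (Q : quiver X) : quiver X :=
  Quiver (mutation_skew x Q).

(* The head of the sequence is the vertex mutated first. *)
Definition mutations (X : eqType) (Q : quiver X) (s : seq X) : quiver X :=
  foldl (fun Q' x => mutation x Q') Q s.

Definition preserves_arrows (X Y : Type) (A : quiver X) (B : quiver Y)
    (f : X -> Y) : Prop :=
  forall a a', B (f a) (f a') = A a a'.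

Definition is_isomorphism (X Y : Type) (A : quiver X) (B : quiver Y)
    (f : X -> Y) : Prop :=
  bijective f /\ preserves_arrows A B f.

Definition is_embedding (X Y : Type) (A : quiver X) (B : quiver Y)
    (f : X -> Y) : Prop :=
  injective f /\ preserves_arrows A B f.

Definition isomorphic (X Y : Type) (A : quiver X) (B : quiver Y) : Prop :=
  exists f : X -> Y, is_isomorphism A B f.

Definition embeds (X Y : Type) (A : quiver X) (B : quiver Y) : Prop :=
  exists f : X -> Y, is_embedding A B f.

Definition full_subquiver (X : choiceType) (Q : quiver X) (S : {fset X}) :
    quiver S :=
  Quiver (fun x y : S => arrows_skew Q (val x) (val y)).

Definition homogeneous (X : choiceType) (Q : quiver X) : Prop :=
  forall (S T : {fset X}) (f : S -> T),
    is_isomorphism (full_subquiver Q S) (full_subquiver Q T) f ->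
    exists g : X -> X,
      is_isomorphism Q Q g /\ forall s : S, g (val s) = val (f s).

Definition quiver_class := forall X : finType, quiver X -> Prop.

Definition iso_closed (K : quiver_class) : Prop :=
  forall (X Y : finType) (A : quiver X) (B : quiver Y),
    K X A -> isomorphic A B -> K Y B.

Definition hereditary (K : quiver_class) : Prop :=
  forall (X : finType) (A : quiver X) (S : {fset X}),
    K X A -> K S (full_subquiver A S).

Definition joint_embedding (K : quiver_class) : Prop :=
  forall (X Y : finType) (A : quiver X) (B : quiver Y),
    K X A -> K Y B ->
    exists (Z : finType) (C : quiver Z), [/\ K Z C, embeds A C & embeds B C].

Definition amalgamation (K : quiver_class) : Prop :=
  forall (X Y Z : finType) (A : quiver X) (B : quiver Y) (C : quiver Z)
    (f : X -> Y) (g : X -> Z),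
    K X A -> K Y B -> K Z C -> is_embedding A B f -> is_embedding A C g ->
    exists (W : finType) (D : quiver W) (f' : Y -> W) (g' : Z -> W),
      [/\ K W D, is_embedding B D f', is_embedding C D g'
        & forall a, f' (f a) = g' (g a)].

Definition fraisse_class (K : quiver_class) : Prop :=
  [/\ iso_closed K, hereditary K, joint_embedding K & amalgamation K].

Definition mutation_closed (K : quiver_class) : Prop :=
  forall (X : finType) (A : quiver X) (x : X), K X A -> K X (mutation x A).

Definition age (X : Type) (Q : quiver X) : quiver_class :=
  fun Y A => embeds A Q.

(* Countability of the limit is carried by the vertex type; a finite limit is
   allowed. *)
Definition is_fraisse_limit (K : quiver_class) (X : countType) (Q : quiver X) :
    Prop :=
  homogeneous Q /\ forall (Y : finType) (A : quiver Y), K Y A <-> age Q A.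

(* Membership of Q' in the finite-mutation-equivalence class of Q, isomorphic
   quivers being identified; Q' may live on another vertex type. *)
Definition finite_mutation_equivalent (X : eqType) (Y : Type)
    (Q : quiver X) (Q' : quiver Y) : Prop :=
  exists s : seq X, isomorphic (mutations Q s) Q'.

(* Main.v *)
(** A Fraïssé limit is determined, among countable quivers, by having its finite
full subquivers in [K] and by the extension property: an embedding of [A] in the
quiver extends along every embedding of [A] in a member [B] of [K].  Mutation at
[x] preserves both. If [x] lies in the image of [A], mutate [A] and [B] at the
vertex over [x], extend into the unmutated quiver, and mutate back, mutation
being an involution compatible with embeddings.  Otherwise first enlarge [A] by
[x] and amalgamate with [B].  Back-and-forth then yields the isomorphism. *)

Require Import Defs.
From mathcomp Require Import all_boot all_order all_algebra.
From mathcomp Require Import finmap.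
From mathcomp Require Import ring zify.
Set Implicit Arguments.
Unset Strict Implicit.
Unset Printing Implicit Defensive.
Import GRing.Theory.

Local Open Scope fset_scope.
Local Open Scope ring_scope.

(** * Isomorphisms, embeddings and their images *)

Lemma isomorphic_sym (X Y : Type) (A : quiver X) (B : quiver Y) :
  isomorphic A B -> isomorphic B A.
Proof.
case=> f [[g fK gK] fP]; exists g; split; first by exists f.
by move=> b b'; rewrite -fP !gK.
Qed.

Lemma isomorphic_trans (X Y Z : Type) (A : quiver X) (B : quiver Y)
    (C : quiver Z) :
  isomorphic A B -> isomorphic B C -> isomorphic A C.
Proof.
case=> f [fbij fP] [g [gbij gP]]; exists (g \o f); split; first exact: bij_comp.
by move=> a a' /=; rewrite gP fP.
Qed.

Lemma embedding_comp (X Y Z : Type) (A : quiver X) (B : quiver Y)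
    (C : quiver Z) (f : X -> Y) (g : Y -> Z) :
  is_embedding A B f -> is_embedding B C g -> is_embedding A C (g \o f).
Proof.
case=> finj fP [ginj gP]; split; first exact: inj_comp.
by move=> a a' /=; rewrite gP fP.
Qed.

Lemma full_subquiver_embedding (X : choiceType) (Q : quiver X) (S : {fset X}) :
  is_embedding (full_subquiver Q S) Q val.
Proof. by split=> //; exact: val_inj. Qed.

Lemma embedding_corestrict (X : finType) (Y : choiceType) (A : quiver X)
    (Q : quiver Y) (e : X -> Y) (S : {fset Y}) :
  is_embedding A Q e -> (forall a, e a \in S) ->
  exists k : X -> S,
    is_embedding A (full_subquiver Q S) k /\ forall a, val (k a) = e a.
Proof.
move=> [einj eP] eS; exists (fun a => [` eS a]); split=> //; split.
  by move=> a a' /(congr1 val)/= /einj.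
by move=> a a'; exact: eP.
Qed.

(** Turns embeddings, in which ages are phrased, into isomorphisms onto full subquivers, which
    heredity and homogeneity speak about. *)
Lemma embedding_image (X : finType) (Y : choiceType) (A : quiver X)
    (Q : quiver Y) (e : X -> Y) :
  is_embedding A Q e ->
  exists (S : {fset Y}) (k : X -> S),
    is_isomorphism A (full_subquiver Q S) k /\ forall a, val (k a) = e a.
Proof.
move=> eE; pose S := [fset e a | a in X].
have eS a : e a \in S by rewrite in_imfset.
have [k [[kinj kP] kE]] := embedding_corestrict eE eS.
exists S, k; do 2!split=> //.
have kS (s : S) : exists a, k a == s.
  have /imfsetP[a _ sE] := fsvalP s.
  by exists a; apply/eqP/val_inj; rewrite kE.
exists (fun s => xchoose (kS s)) => [a|s]; last exact/eqP/(xchooseP (kS s)).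
by apply: kinj; apply/eqP/(xchooseP (kS (k a))).
Qed.

(** * Mutation: restriction and involutivity *)

(** The mutated value at [v], [w] involves only the arrows among [a], [v], [w], all of which lie in
    the embedded part. *)
Lemma mutation_embedding (X Y : eqType) (A : quiver X) (B : quiver Y)
    (f : X -> Y) (a : X) :
  is_embedding A B f -> is_embedding (mutation a A) (mutation (f a) B) f.
Proof.
case=> finj fP; split=> // v w.
by rewrite /= /mutation_fun !(inj_eq finj) !fP.
Qed.

Lemma mutationK (X : eqType) (x : X) (Q : quiver X) v w :
  mutation x (mutation x Q) v w = Q v w.
Proof.
rewrite /= {1}/mutation_fun; case: ifP => [xvw|].
  by rewrite /= /mutation_fun xvw opprK.
rewrite /= /mutation_fun !eqxx orbT => /= ->.
(* The second mutation sees the arrows at [x] reversed; the two corrections cancel because $[c]_+ -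
   [-c]_+ = c$. *)
have pos_partB (c : int) : pos_part c = c + pos_part (- c).
  by rewrite /pos_part; lia.
rewrite opprK (pos_partB (Q x w)) (pos_partB (Q v x)); ring.
Qed.

(* By Fraïssé's theorem this characterises the countable limit, in a form that
   is easier to transport along a mutation than homogeneity. *)
Definition rich (K : quiver_class) (X : Type) (Q : quiver X) : Prop :=
  (forall (Y : finType) (A : quiver Y), age Q A -> K Y A) /\
  (forall (Y Z : finType) (A : quiver Y) (B : quiver Z) (f : Y -> Z)
      (g : Y -> X), K Z B -> is_embedding A B f -> is_embedding A Q g ->
    exists h : Z -> X, is_embedding B Q h /\ forall a, h (f a) = g a).

Lemma class_embeds (K : quiver_class) (X Y : finType) (A : quiver X)
    (B : quiver Y) :
  iso_closed K -> hereditary K -> K Y B -> embeds A B -> K X A.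
Proof.
move=> Kiso Kher KB [e /embedding_image[S [k [kI _]]]].
by apply: Kiso (Kher _ _ S KB) (isomorphic_sym _); exists k.
Qed.

(** Embed [B] anywhere in [Q] by [e]. Then [e \o f] and [g] give two copies of [A], and an
    automorphism [t] carrying the first to the second makes [t \o e] extend [g]. *)
Lemma fraisse_limit_rich (K : quiver_class) (X : countType) (Q : quiver X) :
  is_fraisse_limit K Q -> rich K Q.
Proof.
move=> [Qhom Qage]; split=> [Y A /Qage //|Y Z A B f g /Qage[e eE] fE gE].
have [S [k [[[k' kK k'K] kP] kE]]] :=
  embedding_image (embedding_comp fE eE).
have [T [l [[lbij lP] lE]]] := embedding_image gE.
have kl : is_isomorphism (full_subquiver Q S) (full_subquiver Q T) (l \o k').
  split; first by apply: bij_comp => //; exists k.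
  by move=> s s'; rewrite -[in RHS](k'K s) -[in RHS](k'K s') kP; exact: lP.
have [t [[tbij tP] tE]] := Qhom _ _ _ kl.
exists (t \o e); split.
  by apply: embedding_comp eE _; split=> //; exact: bij_inj.
by move=> a; rewrite -lE -[a in RHS]kK -[RHS]tE kE.
Qed.

Lemma mutation_rich (K : quiver_class) (X : choiceType) (Q : quiver X) (x : X) :
  fraisse_class K -> mutation_closed K -> rich K Q -> rich K (mutation x Q).
Proof.
move=> [Kiso Kher _ Kam] Kmut [Qage Qext].
have mutK (Y : eqType) (A : quiver Y) a (f : Y -> X) :
    is_embedding (mutation a (mutation a A)) (mutation x Q) f ->
    is_embedding A (mutation x Q) f.
  by case=> finj fP; split=> // v w; rewrite fP mutationK.
(* Restriction to [S] commutes with mutation at [x] once [x] lies in [S]; hence the enlargement by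
   [x] in [age_sub]. *)
have Kx (S : {fset X}) : x \in S -> K S (full_subquiver (mutation x Q) S).
  move=> xS; have /(Kmut _ _ [` xS]) KS : K S (full_subquiver Q S).
    by apply: Qage; exists val; exact: full_subquiver_embedding.
  by apply: (Kiso _ _ _ _ KS); exists id; split; [exists id | move=> v w].
have age_sub (Y : finType) (A : quiver Y) (g : Y -> X) :
    is_embedding A (mutation x Q) g ->
  exists (S : {fset X}) (k : Y -> S), [/\ x \in S,
    is_embedding A (full_subquiver (mutation x Q) S) k
    & forall a, val (k a) = g a].
  move=> gE; pose S := x |` [fset g a | a in Y].
  have gS a : g a \in S by apply/fset1Ur; rewrite in_imfset.
  have [k [kE kg]] := embedding_corestrict gE gS.
  by exists S, k; split=> //; exact: fset1U1.
have Kage (Y : finType) (A : quiver Y) : age (mutation x Q) A -> K Y A.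
  case=> g /age_sub[S [k [xS kE _]]].
  by apply: class_embeds (Kx S xS) _ => //; exists k.
have ext_at (Y Z : finType) (A : quiver Y) (B : quiver Z) (f : Y -> Z)
    (g : Y -> X) a : g a = x -> K Z B -> is_embedding A B f ->
    is_embedding A (mutation x Q) g ->
  exists h : Z -> X,
    is_embedding B (mutation x Q) h /\ forall a, h (f a) = g a.
  move=> ga /(Kmut _ _ (f a)) KB /(mutation_embedding a) fE.
  move=> /(mutation_embedding a); rewrite ga => -[ginj gP].
  (* Undoing the mutation at [x] places the mutated [A] in [Q] itself, where the extension property
     is known. *)
  have gE : is_embedding (mutation a A) Q g.
    by split=> // v w; rewrite -gP mutationK.
  have [h [hE hf]] := Qext _ _ _ _ _ _ KB fE gE; exists h; split=> //.
  apply: (mutK _ _ (f a)); rewrite -[in mutation x Q]ga -hf.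
  exact: mutation_embedding.
split=> // Y Z A B f g KB fE gE.
have [S [k [xS kE kg]]] := age_sub _ _ _ gE.
have KA : K Y A by apply: Kage; exists g.
(* The amalgam [D] contains both [B] and the subquiver on [S]; since [S] contains [x], its inclusion
   extends to [D] by the case already settled. *)
have [W [D [f' [g' [KD f'E g'E fg]]]]] :=
  Kam _ _ _ _ _ _ _ _ KA KB (Kx S xS) fE kE.
have [h [hE hg']] := ext_at _ _ _ _ g' val [` xS] erefl KD g'E
  (full_subquiver_embedding (mutation x Q) S).
exists (h \o f'); split; first exact: embedding_comp f'E hE.
by move=> a; rewrite /= fg hg' kg.
Qed.

Lemma mutations_rich (K : quiver_class) (X : choiceType) (Q : quiver X)
    (s : seq X) :
  fraisse_class K -> mutation_closed K -> rich K Q -> rich K (mutations Q s).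
Proof.
by move=> KF Kmut; elim: s Q => //= x s IH Q Qrich; apply/IH/mutation_rich.
Qed.

(* A finite partial isomorphism is encoded as the list of pairs in its graph. *)
Definition compatible (X Y : eqType) (P : quiver X) (Q : quiver Y)
    (p q : X * Y) : bool :=
  ((p.1 == q.1) == (p.2 == q.2)) && (P p.1 q.1 == Q p.2 q.2).

Definition partial_iso (X Y : eqType) (P : quiver X) (Q : quiver Y)
    (l : seq (X * Y)) : bool :=
  all2rel (compatible P Q) l.

Lemma partial_isoP (X Y : eqType) (P : quiver X) (Q : quiver Y) l :
  reflect {in l &, forall p q, compatible P Q p q} (partial_iso P Q l).
Proof. exact: allrelP. Qed.

(** Reduces the back step to the forth step with the two quivers exchanged. *)
Lemma partial_iso_swap (X Y : eqType) (P : quiver X) (Q : quiver Y) l :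
  partial_iso P Q [seq (p.2, p.1) | p <- l] = partial_iso Q P l.
Proof.
rewrite /partial_iso allrel_mapl allrel_mapr; apply: eq_allrel => p q.
by rewrite /compatible /= eq_sym [X in _ && X]eq_sym.
Qed.

(** The domain [S] of [l] embeds in [Q] along [l]; extending this embedding to [S] with [x] added
    yields the partner of [x]. *)
Lemma rich_forth (K : quiver_class) (X Y : choiceType) (P : quiver X)
    (Q : quiver Y) l x :
  rich K P -> rich K Q -> partial_iso P Q l ->
  exists y, partial_iso P Q ((x, y) :: l).
Proof.
move=> [Page _] [_ Qext] /partial_isoP lP.
pose S := [fset p.1 | p in l]; pose S' := x |` S.
have lS (s : S) : exists y, (val s, y) \in l.
  by have /imfsetP[[u v] /= uvl ->] := fsvalP s; exists v.
pose g s := xchoose (lS s); have gl s : (val s, g s) \in l := xchooseP (lS s).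
have gE : is_embedding (full_subquiver P S) Q g.
  split=> [s s' gss'|s s'];
    have /andP[/= /eqP e1 /eqP e2] := lP _ _ (gl s) (gl s').
    by apply/val_inj/eqP; rewrite e1 gss'.
  by rewrite -e2.
have SS' (s : S) : val s \in S' by apply/fset1Ur/fsvalP.
have [f [fE fv]] := embedding_corestrict (full_subquiver_embedding P S) SS'.
have KS' : K S' (full_subquiver P S').
  by apply: Page; exists val; exact: full_subquiver_embedding.
have [h [[hinj hP] hf]] := Qext _ _ _ _ _ _ KS' fE gE.
have xS' : x \in S' by rewrite fset1U1.
exists (h [` xS']).
(* All pairs lie on the graph of [h]: compatibility makes [l] single-valued, so the chosen [g]
   agrees with every pair of [l]. *)
have hl p : p \in (x, h [` xS']) :: l ->
    exists2 s : S', val s = p.1 & h s = p.2.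
  rewrite inE => /predU1P[->|pl]; first by exists [` xS'].
  have pS : p.1 \in S by rewrite (in_imfset _ (fun p => p.1)).
  exists (f [` pS]); first exact: fv.
  rewrite hf; have /andP[/= /eqP e1 _] := lP _ _ (gl [` pS]) pl.
  by apply/eqP; rewrite -e1.
apply/partial_isoP => p q /hl[s sp sp'] /hl[t tq tq'].
rewrite /compatible -sp -sp' -tq -tq' (inj_eq hinj) (inj_eq val_inj) hP /=.
by rewrite !eqxx.
Qed.

Lemma rich_back (K : quiver_class) (X Y : choiceType) (P : quiver X)
    (Q : quiver Y) l y :
  rich K P -> rich K Q -> partial_iso P Q l ->
  exists x, partial_iso P Q ((x, y) :: l).
Proof.
move=> Prich Qrich; rewrite -partial_iso_swap => /(rich_forth y Qrich Prich)[x].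
by move=> xl; exists x; rewrite -partial_iso_swap.
Qed.

(** The task of stage [n] in the back-and-forth; a number coding no vertex imposes nothing, so
    finite vertex types are covered. *)
Definition meets_nth (X : countType) (n : nat) (s : seq X) : bool :=
  if choice.unpickle n is Some x then x \in s else true.

Lemma meets_nth_sub (X : countType) n (s s' : seq X) :
  {subset s <= s'} -> meets_nth n s -> meets_nth n s'.
Proof.
by move=> ss'; rewrite /meets_nth; case: choice.unpickle => // x /ss'.
Qed.

Lemma meets_nth_pickle (X : countType) (x : X) s :
  meets_nth (choice.pickle x) s = (x \in s).
Proof. by rewrite /meets_nth choice.pickleK. Qed.

(** One stage: a forth step, then a back step. The boolean conclusion lets [xchoose] pick the
    extension without a choice axiom. *)
Lemma rich_extend (K : quiver_class) (X Y : countType) (P : quiver X)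
    (Q : quiver Y) n l :
  rich K P -> rich K Q -> partial_iso P Q l ->
  exists l', [&& partial_iso P Q l', all [in l'] l,
    meets_nth n (unzip1 l') & meets_nth n (unzip2 l')].
Proof.
move=> Prich Qrich lP.
have [l1 [l1P ll1 l1x]] : exists l1,
    [/\ partial_iso P Q l1, {subset l <= l1} & meets_nth n (unzip1 l1)].
  rewrite /meets_nth; case: choice.unpickle => [x|]; last by exists l; split.
  have [y yP] := rich_forth x Prich Qrich lP.
  by exists ((x, y) :: l); split=> [//|p pl|]; rewrite inE ?pl ?orbT ?eqxx.
have [l2 [l2P ll2 l2y]] : exists l2,
    [/\ partial_iso P Q l2, {subset l1 <= l2} & meets_nth n (unzip2 l2)].
  rewrite /meets_nth; case: choice.unpickle => [y|]; last by exists l1; split.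
  have [x xP] := rich_back y Prich Qrich l1P.
  by exists ((x, y) :: l1); split=> [//|p pl|]; rewrite inE ?pl ?orbT ?eqxx.
exists l2; rewrite l2P l2y andbT /=; apply/andP; split.
  by apply/allP => p /ll1/ll2.
apply: meets_nth_sub l1x => _ /mapP[p pl1 ->].
by apply: map_f; exact: ll2.
Qed.

Lemma rich_isomorphic (K : quiver_class) (X Y : countType) (P : quiver X)
    (Q : quiver Y) :
  rich K P -> rich K Q -> isomorphic P Q.
Proof.
move=> Prich Qrich.
pose step n (l : {l | partial_iso P Q l}) : {l | partial_iso P Q l} :=
  let e := rich_extend n Prich Qrich (valP l) in
  exist _ (xchoose e) (proj1 (andP (xchooseP e))).
pose fix chain n : {l | partial_iso P Q l} :=
  if n is n'.+1 then step n' (chain n') else exist _ [::] isT.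
have chainS n : [&& all [in val (chain n.+1)] (val (chain n)),
    meets_nth n (unzip1 (val (chain n.+1))) &
    meets_nth n (unzip2 (val (chain n.+1)))].
  by have /andP[] := xchooseP (rich_extend n Prich Qrich (valP (chain n))).
have chain_sub m n : (m <= n)%N -> {subset val (chain m) <= val (chain n)}.
  elim: n => [|n IH]; first by rewrite leqn0 => /eqP->.
  rewrite leq_eqVlt => /predU1P[->//|/IH mn p /mn].
  by have /andP[/allP + _] := chainS n; apply.
(* Any two pairs occur together in a later stage, so the union of the chain is a partial
   isomorphism. *)
have chainP m n p q : p \in val (chain m) -> q \in val (chain n) ->
    compatible P Q p q.
  move=> /(chain_sub _ _ (leq_maxl m n)) pc /(chain_sub _ _ (leq_maxr m n)) qc.
  exact: (partial_isoP _ _ _ (valP (chain (maxn m n)))).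
(* Stage [n] is carried out in passing from [chain n] to [chain n.+1], hence the successor in the
   witness. *)
have fex x : exists ny : nat * Y, (x, ny.2) \in val (chain ny.1).
  have /and3P[_ + _] := chainS (choice.pickle x).
  rewrite meets_nth_pickle => /mapP[[u y] uy ->].
  by exists ((choice.pickle x).+1, y).
have gex y : exists nx : nat * X, (nx.2, y) \in val (chain nx.1).
  have /and3P[_ _] := chainS (choice.pickle y).
  rewrite meets_nth_pickle => /mapP[[x u] xu ->].
  by exists ((choice.pickle y).+1, x).
pose f x := (xchoose (fex x)).2; pose g y := (xchoose (gex y)).2.
have fP x := xchooseP (fex x); have gP y := xchooseP (gex y).
exists f; split.
  (* The pairs of [f x] and of [g (f x)] share their second entry, so compatibility forces equal
     first entries; the other composite is symmetric. *)
  exists g => [x|y].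
    have /andP[/= /eqP e _] := chainP _ _ _ _ (gP (f x)) (fP x).
    by apply/eqP; rewrite e.
  have /andP[/= /eqP e _] := chainP _ _ _ _ (fP (g y)) (gP y).
  by apply/eqP; rewrite -e.
by move=> x x'; have /andP[_ /eqP/= <-] := chainP _ _ _ _ (fP x) (fP x').
Qed.

Theorem theorem1p5 (K : quiver_class) (X : countType) (Q : quiver X)
    (hK : fraisse_class K) (hmut : mutation_closed K)
    (hQ : is_fraisse_limit K Q) :
  (forall s : seq X, isomorphic (mutations Q s) Q) /\
  (forall (Y : Type) (Q' : quiver Y),
     finite_mutation_equivalent Q Q' <-> isomorphic Q Q').
Proof.
have Qrich := fraisse_limit_rich hQ.
have iso_mut s : isomorphic (mutations Q s) Q.
  exact: rich_isomorphic (mutations_rich s hK hmut Qrich) Qrich.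
(* For the converse, the empty sequence of mutations suffices. *)
split=> // Y Q'; split=> [[s]|QQ']; last by exists [::].
exact/isomorphic_trans/isomorphic_sym/iso_mut.
Qed.
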